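(* Let $\mathbf{E}_J$ be a $W$-graph ideal with respect to $J\subseteq S$ and $L$, with module $M=M(\mathbf{E}_J,L)$, and let $\hat M=\hat M(\mathbf{E}_J,L)=\mathrm{Hom}_A(M,A)$. The $\mathcal H$-module $\hat M$ has a unique basis $\{D_z\mid z\in\mathbf{E}_J\}$ such that $\overline{D_z}=D_z$ for all $z\in\mathbf{E}_J$ and $$D_z=\sum_{y\in\mathbf{E}_J}Q_{z,y}\hat\Gamma_y$$ for some elements $Q_{z,y}\in A_{\geqslant0}$ with the following properties: (a1) $Q_{z,y}=0$ if $z\not\leqslant y$; (a2) $Q_{z,z}=1$; (a3) $Q_{z,y}$ has zero constant term if $z\neq y$, and $$Q_{z,y}-\overline{Q_{z,y}}=\sum_{\substack{z\leqslant x<y\\ x\in\mathbf{E}_J}}\overline{Q_{z,x}}\,R_{x,y}\qquad\text{for any } z<y.$$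
   Context: Let $(W,S)$ be a Coxeter system with length function $\ell$ and Bruhat order $\leqslant$. Let $\Gamma$ be a totally ordered abelian group (written additively) and $L:W\to\Gamma$ a weight function: elements $L(s)\in\Gamma$ ($s\in S$) are given with $L(s)=L(t)$ whenever $s,t$ are conjugate in $W$, and $L(w)=L(s_1)+\dots+L(s_k)$ for a reduced expression $w=s_1\cdots s_k$. Assume $L(s)\geqslant 0$ for all $s\in S$. Let $R\subseteq\mathbb C$ be a subring and $A=R[\Gamma]$ the group algebra, with $R$-basis $\{q^\gamma\mid\gamma\in\Gamma\}$, $q^\gamma q^{\gamma'}=q^{\gamma+\gamma'}$. $A_{\geqslant0}$, $A_{>0}$ are the sets of $R$-linear combinations of $q^\gamma$ with $\gamma\geqslant 0$, $\gamma>0$; the constant term is the coefficient of $q^0$. The ring involution $a\mapsto\overline a$ of $A$ is the $R$-linear map with $\overline{q^\gamma}=q^{-\gamma}$. $\mathcal H$ is the Hecke algebra over $A$ with basis $\{T_w\mid w\in W\}$ and $T_sT_w=T_{sw}$ if $\ell(sw)>\ell(w)$, $T_sT_w=T_{sw}+(q^{L(s)}-q^{-L(s)})T_w$ if $\ell(sw)<\ell(w)$. It has the ring involution $\overline{\sum a_wT_w}=\sum\overline{a_w}\,T_{w^{-1}}^{-1}$. For $J\subseteq S$ let $D_J=\{w\in W\mid\ell(ws)>\ell(w)\text{ for all }s\in J\}$. The left weak order: $x\leqslant_L y$ iff $y=zx$ with $\ell(y)=\ell(z)+\ell(x)$. Let $\mathbf{E}_J$ be a (nonempty) ideal, i.e.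 down-closed subset, of $(W,\leqslant_L)$ with $\mathbf{E}_J\subseteq D_J$. For $s\in S$ put $\mathbf{E}_{J,s}^-=\{w\in\mathbf{E}_J\mid\ell(sw)<\ell(w),\ sw\in\mathbf{E}_J\}$, $\mathbf{E}_{J,s}^+=\{w\in\mathbf{E}_J\mid\ell(sw)>\ell(w),\ sw\in\mathbf{E}_J\}$, $\mathbf{E}_{J,s}^{0,-}=\{w\in\mathbf{E}_J\mid\ell(sw)>\ell(w),\ sw\notin D_J\}$, $\mathbf{E}_{J,s}^{0,+}=\{w\in\mathbf{E}_J\mid\ell(sw)>\ell(w),\ sw\in D_J\setminus\mathbf{E}_J\}$. $\mathbf{E}_J$ is a $W$-graph ideal with respect to $J$ and $L$ if: (i) there is an $A$-free $\mathcal H$-module $M(\mathbf{E}_J,L)$ with $A$-basis $\{\Gamma_w\mid w\in\mathbf{E}_J\}$ such that for all $s\in S$, $w\in\mathbf{E}_J$: $T_s\Gamma_w=\Gamma_{sw}+(q^{L(s)}-q^{-L(s)})\Gamma_w$ if $w\in\mathbf{E}_{J,s}^-$; $T_s\Gamma_w=\Gamma_{sw}$ if $w\in\mathbf{E}_{J,s}^+$; $T_s\Gamma_w=-q^{-L(s)}\Gamma_w$ if $w\in\mathbf{E}_{J,s}^{0,-}$; $T_s\Gamma_w=q^{L(s)}\Gamma_w-\sum_{z\in\mathbf{E}_J,\,z<w}r^s_{z,w}\Gamma_z$ if $w\in\mathbf{E}_{J,s}^{0,+}$, for some $r^s_{z,w}\in q^{L(s)}A_{>0}$; (ii) $M(\mathbf{E}_J,L)$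 admits an $A$-semilinear involution $\alpha\mapsto\overline\alpha$ with $\overline{\Gamma_1}=\Gamma_1$ and $\overline{h\alpha}=\overline h\,\overline\alpha$ for all $h\in\mathcal H$, $\alpha\in M(\mathbf{E}_J,L)$. The elements $R_{x,y}\in A$ are defined by $\overline{\Gamma_y}=\sum_{x\in\mathbf{E}_J}R_{x,y}\Gamma_x$. On $\hat M=\mathrm{Hom}_A(M,A)$ the left $\mathcal H$-module structure is defined by $(hf)(m)=f(hm)$ for $f\in\hat M$, $m\in M$, $h\in\mathcal H$, and the bar operator by $\overline f(m)=\overline{f(\overline m)}$. For $z\in\mathbf{E}_J$, $\hat\Gamma_z\in\hat M$ is defined by $\hat\Gamma_z(\Gamma_w)=\delta_{z,w}$ for $w\in\mathbf{E}_J$; $\{\hat\Gamma_z\mid z\in\mathbf{E}_J\}$ is taken as an $A$-basis of $\hat M$.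
   Formalization: In (a3) the factor R_{x,y} is replaced by its bar, as bar-invariance of D_z forces; the printed formula fails for W={1,s}, J=∅, L(s)>0. For infinite E_J, ''basis'' of the dual module is meant with pointwise finite (possibly infinite) sums. *)

(* Defs.v *)
From HB Require Import structures.
From mathcomp Require Import all_boot all_order all_algebra.
From mathcomp Require Export monoid.
From mathcomp Require Import all_classical all_reals.
From mathcomp Require Import complex.

Set Implicit Arguments.
Unset Strict Implicit.
Unset Printing Implicit Defensive.

Import Order.TTheory GRing.Theory Num.Theory.
Local Open Scope classical_set_scope.
Local Open Scope ring_scope.

(* ------------------------------------------------------------------------ *)
(* Bases indexed by a possibly infinite set                                  *)

Section Bases.
Context {K : nzRingType} {V : lmodType K} {I : choiceType}.
Implicit Types (E : set I) (b : I -> V) (c : I -> K) (v : V).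

(* v is the finite linear combination of the b i, i in E, with coefficients
   c i; the values of b and c outside E are irrelevant. *)
Definition lincomb E b c v : Prop :=
  finite_set (E `&` [set i | c i != 0]) /\ v = \sum_(i \in E) c i *: b i.

Definition is_basis E b : Prop :=
  forall v, (exists c, lincomb E b c v) /\
    (forall c c', lincomb E b c v -> lincomb E b c' v ->
       forall i, E i -> c i = c' i).

End Bases.

(* Families in the dual Hom_K(V, K).  When E is infinite, the forms dual to a
   basis (b i), i in E, generate Hom_K(V, K) only through infinite sums that
   are finite at each vector; "basis" of the dual is meant in that sense.
   For finite E these are the usual notions. *)
Section DualBases.
Context {K : comNzRingType} {V : lmodType K} {I : choiceType}.
Implicit Types (E : set I) (F : I -> {linear V -> K^o}) (c : I -> K).

Definition pointwise_finite E F : Prop :=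
  forall v, finite_set (E `&` [set i | F i v != 0]).

Definition dual_lincomb E F c (f : V -> K) : Prop :=
  pointwise_finite E F /\ forall v, f v = \sum_(i \in E) c i * F i v.

Definition is_dual_basis E F : Prop :=
  pointwise_finite E F /\
  forall f : {linear V -> K^o}, (exists c, dual_lincomb E F c f) /\
    (forall c c', dual_lincomb E F c f -> dual_lincomb E F c' f ->
       forall i, E i -> c i = c' i).

End DualBases.

(* ------------------------------------------------------------------------ *)
(* Coxeter systems                                                           *)

Section Coxeter.
Context {W : groupType}.
Implicit Types (S J E : set W) (s t w x y : W) (u v : seq W).

Definition word S u : Prop := forall s, s \in u -> S s.

Definition wprod u : W := (\prod_(s <- u) s)%g.

Definition has_order x (m : nat) : Prop :=
  [/\ (0 < m)%N, (x ^+ m = 1)%g &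
      forall k, (0 < k < m)%N -> (x ^+ k <> 1)%g].

(* The congruence on words generated by (st)^m = 1, where m is the (finite)
   order of st.  The case s = t gives ss = 1, so this monoid presentation is
   also the group presentation. *)
Inductive cox_rel S : seq W -> seq W -> Prop :=
| cox_rel_refl u : cox_rel S u u
| cox_rel_sym u v : cox_rel S u v -> cox_rel S v u
| cox_rel_trans u v u' : cox_rel S u v -> cox_rel S v u' -> cox_rel S u u'
| cox_rel_cat u u' v v' :
    cox_rel S u u' -> cox_rel S v v' -> cox_rel S (u ++ v) (u' ++ v')
| cox_rel_braid s t m : S s -> S t -> has_order (s * t)%g m ->
    cox_rel S (flatten (nseq m [:: s; t])) [::].

Record coxeter_system S : Prop := {
  cox_invol : forall s, S s -> has_order s 2;
  cox_gen : forall w, exists u, word S u /\ wprod u = w;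
  cox_pres : forall u v, word S u -> word S v -> wprod u = wprod v ->
    cox_rel S u v }.

Definition expr_size S w (n : nat) : Prop :=
  exists u, [/\ word S u, size u = n & wprod u = w].

Definition len S w : nat :=
  xget 0%N [set n | expr_size S w n /\
                    forall k, expr_size S w k -> (n <= k)%N].

Definition reflection S t : Prop := exists s w, S s /\ t = (s ^ w)%g.

Inductive bruhat_le S : W -> W -> Prop :=
| bruhat_refl x : bruhat_le S x x
| bruhat_step x y t : bruhat_le S x y -> reflection S t ->
    (len S y < len S (t * y)%g)%N -> bruhat_le S x (t * y)%g.

Definition bruhat_lt S x y : Prop := bruhat_le S x y /\ x <> y.

Definition left_weak_le S x y : Prop :=
  exists z, y = (z * x)%g /\ len S y = (len S z + len S x)%N.

Definition left_weak_ideal S E : Prop :=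
  forall x y, left_weak_le S x y -> E y -> E x.

Definition coset_reps S J : set W :=
  [set w | forall s, J s -> (len S w < len S (w * s)%g)%N].

Definition E_minus S E s : set W :=
  [set w | [/\ E w, (len S (s * w)%g < len S w)%N & E (s * w)%g]].
Definition E_plus S E s : set W :=
  [set w | [/\ E w, (len S w < len S (s * w)%g)%N & E (s * w)%g]].
Definition E_zero_minus S J E s : set W :=
  [set w | [/\ E w, (len S w < len S (s * w)%g)%N
             & ~ coset_reps S J (s * w)%g]].
Definition E_zero_plus S J E s : set W :=
  [set w | [/\ E w, (len S w < len S (s * w)%g)%N
             & (coset_reps S J `\` E) (s * w)%g]].

End Coxeter.

(* ------------------------------------------------------------------------ *)
(* Ordered groups, weight functions, group algebras                          *)

(* porderZmodType does not relate the order to the addition. *)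
Definition ordered_group (G : porderZmodType) : Prop :=
  (forall x y : G, (x <= y) || (y <= x)) /\
  (forall x y z : G, x <= y -> z + x <= z + y).

Definition weight_function {W : groupType} {G : zmodType}
    (S : set W) (L : W -> G) : Prop :=
  (forall s t w, S s -> S t -> t = (s ^ w)%g -> L s = L t) /\
  (forall u, word S u -> size u = len S (wprod u) ->
     L (wprod u) = \sum_(s <- u) L s).

Section GroupAlgebra.
Context {G : porderZmodType} {K : comNzRingType} {A : comAlgType K}.
Implicit Types (q : G -> A) (a : A).

(* A is the group algebra K[G], with q g the basis element of g. *)
Record is_group_algebra q : Prop := {
  ga_basis : is_basis setT q;
  ga_one : q 0 = 1;
  ga_mul : forall g h, q (g + h) = q g * q h }.

Definition A_ge0 q : set A :=
  [set a | exists c, lincomb [set g | 0 <= g] q c a].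
Definition A_gt0 q : set A :=
  [set a | exists c, lincomb [set g | 0 < g] q c a].

Definition zero_const_term q a : Prop :=
  exists c, lincomb setT q c a /\ c 0 = 0.

Definition is_group_algebra_bar q (barA : {linear A -> A}) : Prop :=
  forall g, barA (q g) = q (- g).

End GroupAlgebra.

(* ------------------------------------------------------------------------ *)
(* Hecke algebras and their modules                                          *)

Definition bar_semilinear {A : nzRingType} {V : lmodType A}
    (barA : A -> A) (f : V -> V) : Prop :=
  forall a x y, f (a *: x + y) = barA a *: f x + f y.

Section Hecke.
Context {W : groupType} {G : porderZmodType} {A : comNzRingType}.
Context {H : algType A}.
Implicit Types (S : set W) (L : W -> G) (q : G -> A) (T : W -> H).

(* The last field is implied by the two others unless S is empty. *)
Record is_hecke_algebra S L q T : Prop := {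
  hecke_basis : is_basis setT T;
  hecke_up : forall s w, S s -> (len S w < len S (s * w)%g)%N ->
    T s * T w = T (s * w)%g;
  hecke_down : forall s w, S s -> (len S (s * w)%g < len S w)%N ->
    T s * T w = T (s * w)%g + (q (L s) - q (- L s)) *: T w;
  hecke_one : T 1%g = 1 }.

Definition is_hecke_bar (barA : A -> A) T (barH : H -> H) : Prop :=
  bar_semilinear barA barH /\
  forall w, barH (T w) * T (w^-1)%g = 1 /\ T (w^-1)%g * barH (T w) = 1.

End Hecke.

(* An H-module, seen as an A-module through a |-> a%:A. *)
Definition base_mod {A : comNzRingType} {H : algType A} (M : lmodType H) : Type
  := M.

Section BaseMod.
Context {A : comNzRingType} {H : algType A} (M : lmodType H).

HB.instance Definition _ := GRing.Zmodule.on (base_mod M).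

Let bscale (a : A) (m : base_mod M) : base_mod M := (a%:A : H) *: (m : M).

Fact base_modA a b m : bscale a (bscale b m) = bscale (a * b) m.
Proof. by rewrite /bscale scalerA mulr_algl scalerA. Qed.
Fact base_mod1 : left_id 1 bscale.
Proof. by move=> m; rewrite /bscale scale1r scale1r. Qed.
Fact base_modDr : right_distributive bscale +%R.
Proof. by move=> a x y; rewrite /bscale scalerDr. Qed.
Fact base_modDl m : {morph bscale^~ m : a b / a + b}.
Proof. by move=> a b; rewrite /bscale scalerDl scalerDl. Qed.

HB.instance Definition _ := GRing.Zmodule_isLmodule.Build A (base_mod M)
  base_modA base_mod1 base_modDr base_modDl.

Definition hact (h : H) (m : base_mod M) : base_mod M := h *: (m : M).

End BaseMod.

(* ------------------------------------------------------------------------ *)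
(* W-graph ideals                                                            *)

Section WGraphIdeal.
Context {W : groupType} {G : porderZmodType} {K : comNzRingType}.
Context {A : comAlgType K} {H : algType A} {M : lmodType H}.
Variables (S J E : set W) (L : W -> G) (q : G -> A) (T : W -> H).
Variables (barA : A -> A) (barH : H -> H).

Record wgraph_ideal_module (Gam : W -> base_mod M)
    (barM : base_mod M -> base_mod M) : Prop := {
  wg_basis : is_basis E Gam;
  wg_minus : forall s w, S s -> E_minus S E s w ->
    hact (T s) (Gam w) = Gam (s * w)%g + (q (L s) - q (- L s)) *: Gam w;
  wg_plus : forall s w, S s -> E_plus S E s w ->
    hact (T s) (Gam w) = Gam (s * w)%g;
  wg_zero_minus : forall s w, S s -> E_zero_minus S J E s w ->
    hact (T s) (Gam w) = - (q (- L s) *: Gam w);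
  wg_zero_plus : forall s w, S s -> E_zero_plus S J E s w ->
    exists r : W -> A,
      (forall z, E z -> bruhat_lt S z w ->
         exists2 a, A_gt0 q a & r z = q (L s) * a) /\
      hact (T s) (Gam w) =
        q (L s) *: Gam w
        - \sum_(z \in E `&` [set z | bruhat_lt S z w]) r z *: Gam z;
  wg_bar_semilinear : bar_semilinear barA barM;
  wg_bar_invol : involutive barM;
  wg_bar_one : barM (Gam 1%g) = Gam 1%g;
  wg_bar_hact : forall h m, barM (hact h m) = hact (barH h) (barM m) }.

(* E is a W-graph ideal with respect to J and L, as witnessed by the module M
   with its basis Gam and its involution barM. *)
Definition wgraph_ideal (Gam : W -> base_mod M)
    (barM : base_mod M -> base_mod M) : Prop :=
  [/\ J `<=` S, E !=set0, left_weak_ideal S E, E `<=` coset_reps S J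
    & wgraph_ideal_module Gam barM].

Definition dual_bar (barM : base_mod M -> base_mod M) (f : base_mod M -> A)
  : base_mod M -> A := fun m => barA (f (barM m)).

(* Evaluating dual_bar (D z) = D z at Gam y gives
     Q z y = \sum_x barA (Q z x) * barA (Rm x y),
   whence the bar over Rm in the last field. *)
Record dual_KL_basis (barM : base_mod M -> base_mod M)
    (Rm : W -> W -> A) (hatGam D : W -> {linear base_mod M -> A^o})
    (Q : W -> W -> A) : Prop := {
  dkl_basis : is_dual_basis E D;
  dkl_bar : forall z, E z -> dual_bar barM (D z) =1 D z;
  dkl_expand : forall z, E z -> dual_lincomb E hatGam (Q z) (D z);
  dkl_ge0 : forall z y, E z -> E y -> A_ge0 q (Q z y);
  dkl_supp : forall z y, E z -> E y -> ~ bruhat_le S z y -> Q z y = 0;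
  dkl_diag : forall z, E z -> Q z z = 1;
  dkl_const : forall z y, E z -> E y -> z <> y -> zero_const_term q (Q z y);
  dkl_rec : forall z y, E z -> E y -> bruhat_lt S z y ->
    Q z y - barA (Q z y) =
      \sum_(x \in E `&` [set x | bruhat_le S z x /\ bruhat_lt S x y])
        barA (Q z x) * barA (Rm x y) }.

End WGraphIdeal.

(* Main.v *)
From HB Require Import structures.
Require Import Defs.
From mathcomp Require Import all_boot all_order all_algebra monoid.
From mathcomp Require Import ring finmap all_classical all_reals complex.

(** The bar operator of the module is unitriangular for the Bruhat order: the
coefficient [Rm x y] of [Gam x] in the bar image of [Gam y] vanishes unless
[x] lies below [y], and [Rm y y = 1] ([bar_unitriangular]).  This is proved by
letting the generators of the Hecke algebra act, and rests on the lifting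
property of the Bruhat order ([bruhat_lift]), itself a consequence of the
strong exchange property ([ltn_inversion]).  The latter is obtained from the
presentation of the Coxeter group by counting modulo 2 how often a reflection
occurs along a word.

Given this, the Kazhdan-Lusztig argument applies in the dual module.  A form
[D z] with values [Q z y] at [Gam y] is fixed by bar if and only if, for all
[y], the difference [Q z y - barA (Q z y)] is the sum [a] over the [x < y]
of [barA (Q z x) * barA (Rm x y)].  This determines [Q z y] by recursion on
the length of [y]: in the group algebra an equation [p - barA p = a] has at
most one solution [p] of nonnegative degrees without constant term
([bar_defect_inj]), and has one as soon as [barA a = - a]
([bar_defect_solve]).  The anti-invariance of [a] follows from the fact that
the bar operator of the dual is an involution ([dual_bar_defect]).

Finally the matrix [Q] is unitriangular as well, and every element has finitely
many elements below it ([bruhat_lower_finite]).  Hence every form is a unique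
pointwise finite combination of the [D z], by solving a triangular system
([unitriangular_dual_basis]). *)

Set Implicit Arguments.
Unset Strict Implicit.
Unset Printing Implicit Defensive.

Import Order.TTheory GRing.Theory Num.Theory.
Local Open Scope classical_set_scope.
Local Open Scope ring_scope.

(** * Inversions, strong exchange and the Bruhat order *)

Section InversionParity.
Context {W : groupType}.
Implicit Types (s t r w : W) (u v : seq W).

Lemma wprod_nil : wprod [::] = 1%g :> W.
Proof. by rewrite /wprod big_nil. Qed.

Lemma wprod_cons s u : wprod (s :: u) = (s * wprod u)%g.
Proof. by rewrite /wprod big_cons. Qed.

Lemma wprod_cat u v : wprod (u ++ v) = (wprod u * wprod v)%g.
Proof. by rewrite /wprod big_cat. Qed.

(** The parity of the number of occurrences of [t] among the reflections
[s_1 .. s_(i-1) s_i s_(i-1)^-1 .. s_1^-1] read off the word [u]; these are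
the elements whose left multiplication deletes one letter of [u]. *)
Fixpoint inv_parity u t : bool :=
  if u is s :: u' then (t == s) (+) inv_parity u' (t ^ s)%g else false.

Lemma inv_parity_cat u v t :
  inv_parity (u ++ v) t = inv_parity u t (+) inv_parity v (t ^ wprod u)%g.
Proof.
elim: u t => [|s u IHu] t /=; first by rewrite wprod_nil conjg1.
by rewrite IHu wprod_cons conjgM addbA.
Qed.

Fixpoint inv_seq u : seq W :=
  if u is s :: u' then s :: [seq (r ^ s^-1)%g | r <- inv_seq u'] else [::].

Lemma inv_parity_mem u t : inv_parity u t -> t \in inv_seq u.
Proof.
elim: u t => [//|s u IHu] t /=; rewrite inE.
case: eqVneq => [//|_] /= /IHu tu.
by apply/mapP; exists (t ^ s)%g; rewrite ?conjgK.
Qed.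

(** The reflections read off the word [st st .. st] are the [(st)^j s], in this
order.  When [(st)^n = 1] the second half of the list repeats the first, so
every parity is even. *)
Lemma inv_parity_braid n s t r : (s^-1 = s)%g -> (t^-1 = t)%g ->
  inv_parity (flatten (nseq n [:: s; t])) r =
    \big[addb/false]_(0 <= j < n.*2) (r == (s * t) ^+ j * s)%g.
Proof.
move=> sV tV; elim: n r => [|n IHn] r; first by rewrite /= big_nil.
rewrite doubleS !big_nat_recl //= expg0 expg1 mul1g IHn.
have -> : (r ^ s == t)%g = (r == s * t * s)%g.
  by rewrite (can2_eq (conjgK s) (conjgKV s)) conjgE invgK sV !mulgA.
congr (_ (+) (_ (+) _)); apply: eq_big_nat => j _.
rewrite -conjgM (can2_eq (conjgK _) (conjgKV _)) conjgE invgK invgM sV tV.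
by rewrite expgS expgSr !mulgA.
Qed.

End InversionParity.

Section CoxeterSystem.
Context {W : groupType} (S : set W) (hS : coxeter_system S).
Implicit Types (s t r w x y : W) (u v : seq W).

Lemma gen_inv s : S s -> (s^-1 = s)%g.
Proof. by case/(cox_invol hS) => _ ss _; apply: mulg1_eq; rewrite -expg2. Qed.

Lemma gen_neq1 s : S s -> s <> 1%g.
Proof. by case/(cox_invol hS) => _ _ /(_ 1%N isT); rewrite expg1. Qed.

Lemma genK s w : S s -> (s * (s * w) = w)%g.
Proof. by move=> /gen_inv sV; rewrite -{1}sV mulKg. Qed.

Lemma reflection_inv t : reflection S t -> (t^-1 = t)%g.
Proof. by case=> s [w [/gen_inv sV ->]]; rewrite -conjVg sV. Qed.

Lemma gen_reflection s : S s -> reflection S s.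
Proof. by move=> Ss; exists s, 1%g; rewrite conjg1. Qed.

Lemma word_cat u v : word S u -> word S v -> word S (u ++ v).
Proof. by move=> Su Sv s; rewrite mem_cat => /orP[/Su|/Sv]. Qed.

Lemma word_cons s u : S s -> word S u -> word S (s :: u).
Proof. by move=> Ss Su x; rewrite inE => /predU1P[->|/Su]. Qed.

Lemma word_consP s u : word S (s :: u) -> S s /\ word S u.
Proof.
by move=> Su; split=> [|x xu]; apply: Su; rewrite inE ?eqxx ?xu ?orbT.
Qed.

(** This is where the presentation is used: the parity is additive along
concatenation and trivial on the braid words, hence depends only on the
element that a word represents. *)
Lemma cox_rel_inv_parity u v : cox_rel S u v ->
  wprod u = wprod v /\ inv_parity u =1 inv_parity v.
Proof.
elim=> {u v} [//|u v _ [-> uv]|u v w _ [-> uv] _ [-> vw]||].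
- by split=> // t; rewrite uv.
- by split=> // t; rewrite uv vw.
- move=> u u' v v' _ [uu' puu'] _ [vv' pvv']; rewrite !wprod_cat uu' vv'.
  by split=> // t; rewrite !inv_parity_cat uu' puu' pvv'.
move=> s t m Ss St [_ stm _]; split=> [|r].
  have wE n : wprod (flatten (nseq n [:: s; t])) = ((s * t) ^+ n)%g.
    elim: n => [|n IHn]; first by rewrite /= wprod_nil expg0.
    by rewrite /= !wprod_cons IHn expgS mulgA.
  by rewrite wE stm wprod_nil.
rewrite inv_parity_braid ?gen_inv //= -addnn.
rewrite (big_cat_nat (leq0n m) (leq_addr m m)) /=.
rewrite -{2}[m]add0n big_addn addnK.
rewrite [X in _ (+) X](_ : _ = \big[addb/false]_(0 <= j < m)
  (r == (s * t) ^+ j * s)%g) ?addbb //.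
by apply: eq_big_nat => j _; rewrite expgnDr stm mulg1.
Qed.

Lemma lenP w : expr_size S w (len S w) /\
  (forall k, expr_size S w k -> (len S w <= k)%N).
Proof.
apply: (xgetPex 0%N (P := [set n | expr_size S w n /\
  forall k, expr_size S w k -> (n <= k)%N])).
have [u [Su <-]] := cox_gen hS w.
have ex : exists n, `[< expr_size S (wprod u) n >].
  by exists (size u); apply/asboolP; exists u.
exists (ex_minn ex); case: ex_minnP => n /asboolP nP n_min.
by split=> // k kP; apply: n_min; apply/asboolP.
Qed.

Lemma reduced_ex w : exists u, [/\ word S u, size u = len S w & wprod u = w].
Proof. by case: (lenP w). Qed.

Lemma len_le u : word S u -> (len S (wprod u) <= size u)%N.
Proof. by move=> Su; case: (lenP (wprod u)) => _; apply; exists u. Qed.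

Lemma len1 : len S 1%g = 0%N.
Proof.
apply/eqP; rewrite -leqn0 -(@wprod_nil W); exact: (@len_le [::]).
Qed.

Lemma len_eq0 w : len S w = 0%N -> w = 1%g.
Proof.
by have [u [_ <- <-]] := reduced_ex w; move/size0nil->; rewrite wprod_nil.
Qed.

Lemma len_mull s w : S s -> (len S (s * w)%g <= (len S w).+1)%N.
Proof.
move=> Ss; have [u [Su <- <-]] := reduced_ex w.
by rewrite -wprod_cons; apply: (@len_le (s :: u)); apply: word_cons.
Qed.

Lemma len_gen s : S s -> len S s = 1%N.
Proof.
move=> Ss; apply/eqP; rewrite eqn_leq -len1 -{1}[s]mulg1 len_mull //= len1.
by rewrite lt0n; apply/eqP => /len_eq0; apply: gen_neq1.
Qed.

Lemma left_descent_ex w : w <> 1%g ->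
  exists2 s, S s & (len S (s * w)%g < len S w)%N.
Proof.
have [[|s u] [Su <- <-]] := reduced_ex w; first by rewrite wprod_nil.
have [Ss {}Su] := word_consP Su; exists s => //.
by rewrite wprod_cons genK //= ltnS len_le.
Qed.

Definition inversion w t : bool := inv_parity (sval (cid (cox_gen hS w))) t.

Lemma inversionE u t : word S u -> inversion (wprod u) t = inv_parity u t.
Proof.
move=> Su; rewrite /inversion; case: cid => v /= [Sv vu].
by have [_ ->] := cox_rel_inv_parity (cox_pres hS Sv Su vu).
Qed.

Lemma inversionM x y t :
  inversion (x * y)%g t = inversion x t (+) inversion y (t ^ x)%g.
Proof.
have [[u [Su <-]] [v [Sv <-]]] := (cox_gen hS x, cox_gen hS y).
by rewrite -wprod_cat !inversionE ?inv_parity_cat //; apply: word_cat.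
Qed.

Lemma inversion_gen s t : S s -> inversion s t = (t == s).
Proof.
move=> Ss; have ->: s = wprod [:: s] by rewrite wprod_cons wprod_nil mulg1.
rewrite inversionE /= ?addbF ?wprod_cons ?wprod_nil ?mulg1 //.
by apply: word_cons => // x; rewrite in_nil.
Qed.

(** Write [t] as the conjugate of a generator [s].  The two outer factors
contribute equal parities, as they cancel in [w^-1 w], and the middle letter
is counted once. *)
Lemma inversion_reflection t : reflection S t -> inversion t t.
Proof.
case=> s [w [Ss ->]]; rewrite {1}conjgE !inversionM conjgK.
rewrite (inversion_gen s Ss) eqxx.
have -> : (s ^ s)%g = s by rewrite conjgE mulKg.
have: inversion (w^-1 * w)%g (s ^ w)%g = false.
  by rewrite mulVg -wprod_nil inversionE.
by rewrite inversionM conjgK; do 2!case: inversion.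
Qed.

Lemma inv_seq_delete u t : word S u -> t \in inv_seq u ->
  exists v, [/\ word S v, (size v < size u)%N & wprod v = (t * wprod u)%g].
Proof.
elim: u t => [//|s u IHu] t /word_consP[Ss Su] /=.
rewrite inE => /predU1P[->|/mapP[r ru ->]].
  by exists u; rewrite wprod_cons genK.
have [v [Sv vu vE]] := IHu r Su ru; exists (s :: v); split=> //.
  exact: word_cons.
by rewrite !wprod_cons vE conjgE invgK -!mulgA mulKg.
Qed.

(** An odd number of occurrences is at least one, and then [t] deletes a letter
from a reduced word. *)
Lemma inversion_ltn w t : inversion w t -> (len S (t * w)%g < len S w)%N.
Proof.
have [u [Su <- <-]] := reduced_ex w; rewrite inversionE // => /inv_parity_mem.
by case/(inv_seq_delete Su)=> v [Sv vu <-]; apply: leq_ltn_trans (len_le Sv) vu.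
Qed.

(** The strong exchange property, in the form that a reflection lengthens [w]
exactly when it is not an inversion of [w]: exactly one of [w] and [t w] has
[t] as an inversion. *)
Lemma ltn_inversion w t : reflection S t ->
  (len S w < len S (t * w)%g)%N = ~~ inversion w t.
Proof.
move=> tR; case: (boolP (inversion w t)) => [/inversion_ltn/ltnW|wt].
  by rewrite leqNgt => /negbTE.
have: inversion (t * w)%g t.
  rewrite inversionM inversion_reflection // conjgE mulKg.
  by rewrite (negbTE wt).
by move/inversion_ltn; rewrite -{1}(reflection_inv tR) mulKg.
Qed.

Lemma len_gen_total s w : S s ->
  (len S (s * w)%g < len S w)%N \/ (len S w < len S (s * w)%g)%N.
Proof.
move=> Ss; rewrite (ltn_inversion _ (gen_reflection Ss)).
by case: (boolP (inversion w s)) => [/inversion_ltn|]; [left|right].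
Qed.

Lemma bruhat_len x y : bruhat_le S x y -> x = y \/ (len S x < len S y)%N.
Proof.
elim=> {x y} [|x y t _ IH _ lty]; first by left.
by right; case: IH => [->//|/ltn_trans->].
Qed.

Lemma bruhat_lt_len x y : bruhat_lt S x y -> (len S x < len S y)%N.
Proof. by case=> /bruhat_len[]. Qed.

Lemma bruhat_trans x y z :
  bruhat_le S x y -> bruhat_le S y z -> bruhat_le S x z.
Proof.
move=> xy yz; elim: yz xy => [//|a b t _ IH tR lt /IH xb].
exact: bruhat_step.
Qed.

Lemma bruhat_gen s y : S s -> (len S y < len S (s * y)%g)%N ->
  bruhat_lt S y (s * y)%g.
Proof.
move=> Ss lt; split; last by move=> E; rewrite -E ltnn in lt.
exact: bruhat_step (bruhat_refl _ _) (gen_reflection Ss) lt.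
Qed.

(** The lifting property.  A Bruhat step [y < t y] either is the multiplication
by [s], or is carried by [s] to the step [s y < (s^-1 t s) (s y)]: moving [s]
across changes the inversion status only of [s] itself. *)
Lemma bruhat_lift s x y : S s -> bruhat_le S x y ->
  (len S y < len S (s * y)%g)%N -> bruhat_le S (s * x)%g (s * y)%g.
Proof.
move=> Ss xy.
have: bruhat_le S (s * x)%g (s * y)%g \/ bruhat_le S (s * x)%g y.
  elim: xy => {x y} [x|x y t xy IH tR lt]; first by left; apply: bruhat_refl.
  case: IH => [IH|IH]; last by right; apply: bruhat_step.
  have [->|ts] := eqVneq t s; first by right.
  left; have -> : (s * (t * y) = (t ^ s) * (s * y))%g.
    by rewrite conjgE -!mulgA genK // gen_inv.
  have tsR : reflection S (t ^ s)%g.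
    by case: tR => r [w [Sr ->]]; exists r, (w * s)%g; rewrite conjgM.
  apply: bruhat_step => //.
  rewrite ltn_inversion // inversionM (inversion_gen _ Ss) -conjgM.
  have -> : (s * s = 1)%g by rewrite -{1}(gen_inv Ss) mulVg.
  rewrite conjg1; have ->: (t ^ s == s)%g = false.
    apply: contraNF ts => /eqP/(congr1 (fun r => r ^ s^-1)%g).
    by rewrite conjgK => ->; rewrite conjgE mulgV mulg1 invgK.
  by rewrite -ltn_inversion.
case=> // sxy lt; apply: bruhat_trans sxy _; exact: (bruhat_gen Ss lt).1.
Qed.

(** A nontrivial chain of Bruhat steps up to [y] ends with a step from [t y],
where [t] is an inversion of [y], and a single word for [y] lists all its
inversions. *)
Lemma bruhat_lower_finite y : finite_set [set x | bruhat_le S x y].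
Proof.
have [n] := ubnP (len S y); elim: n y => // n IHn y; rewrite ltnS => yn.
have [u [Su _ uy]] := reduced_ex y.
pose B t := [set x | bruhat_le S x (t * y)%g /\ (len S (t * y)%g < len S y)%N].
apply: (@sub_finite_set _ _ ([set y] `|` \bigcup_(t in [set` inv_seq u]) B t)).
  move=> x /= xy; rewrite {}/B.
  case: xy uy {IHn yn} => [|a b t ab tR lt] uy; first by left.
  right; have bE : (t * (t * b) = b)%g by rewrite -{1}(reflection_inv tR) mulKg.
  exists t; last by rewrite bE.
  rewrite /=; apply: inv_parity_mem; rewrite -inversionE // uy.
  by apply/negPn; rewrite -ltn_inversion // bE -leqNgt ltnW.
rewrite finite_setU; split; first exact: finite_set1.
apply: bigcup_finite => [|t _]; first exact: finite_seq.
have [lt|nlt] := pselect (len S (t * y)%g < len S y)%N.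
  by apply: sub_finite_set (IHn _ (leq_trans lt yn)) => x [].
by apply: sub_finite_set (finite_set0 W) => x [].
Qed.

End CoxeterSystem.

(** * Bases and linear forms *)

Section FiniteSums.
Context {I : choiceType} {V : nmodType}.
Implicit Types (E X : set I) (F : I -> V).

(** The index set of a finitely supported sum may depend on the vector at which
it is evaluated; passing to a common finite [X] makes such sums comparable. *)
Lemma fsum_on E X F : finite_set X -> (forall i, E i -> ~ X i -> F i = 0) ->
  \sum_(i \in E) F i = \sum_(i <- fset_set (E `&` X)) F i.
Proof.
move=> Xfin F0; rewrite -fsbig_finite; last exact: finite_setIr.
apply/esym/fsbig_widen; first by move=> i [].
by move=> i [Ei nX]; apply: F0 => // Xi; apply: nX.
Qed.

Lemma fsum_single E F i : E i -> (forall j, E j -> j <> i -> F j = 0) ->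
  \sum_(j \in E) F j = F i.
Proof.
move=> Ei F0; rewrite -[RHS](fsbig_set1 +%R i F); apply/esym/fsbig_widen.
  by move=> j ->.
by move=> j [Ej /= ji]; apply: F0.
Qed.

Lemma fsum_neq0 E F : \sum_(i \in E) F i <> 0 -> exists2 i, E i & F i <> 0.
Proof.
apply: contra_notP => /forall2NP nF; apply: fsbig1 => i Ei.
by case: (nF i) => // /contrapT.
Qed.

Lemma fsumD E F F' : finite_set (E `&` [set i | F i != 0]) ->
  finite_set (E `&` [set i | F' i != 0]) ->
  \sum_(i \in E) (F i + F' i) = \sum_(i \in E) F i + \sum_(i \in E) F' i.
Proof.
move=> fF fF'; set X := (E `&` [set i | F i != 0]).
set X' := (E `&` [set i | F' i != 0]).
have Xfin : finite_set (X `|` X') by rewrite finite_setU.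
have F0 i : E i -> ~ (X `|` X') i -> F i = 0.
  by move=> Ei; apply: contra_notP => /eqP Fi; left.
have F'0 i : E i -> ~ (X `|` X') i -> F' i = 0.
  by move=> Ei; apply: contra_notP => /eqP Fi; right.
rewrite !(fsum_on (X := X `|` X')) // ?big_split // => i Ei nX.
by rewrite F0 // F'0 // addr0.
Qed.

End FiniteSums.

Section BasisTheory.
Context {K : nzRingType} {V : lmodType K} {I : choiceType}.
Implicit Types (c : I -> K) (u v : V).

Lemma lincomb_lin (E : set I) (b : I -> V) a c c' u v :
  lincomb E b c u -> lincomb E b c' v ->
  lincomb E b (fun i => a * c i + c' i) (a *: u + v).
Proof.
case=> cfin -> [c'fin ->]; split.
  apply: (@sub_finite_set _ _ ((E `&` [set i | c i != 0]) `|`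
    (E `&` [set i | c' i != 0]))); last by rewrite finite_setU.
  move=> i [Ei] /=; have [->|ci _] := eqVneq (c i) 0; last by left.
  by rewrite mulr0 add0r => ci; right.
have sub (d : I -> K) (e : I -> V) : (forall i, d i = 0 -> e i = 0) ->
    E `&` [set i | e i != 0] `<=` E `&` [set i | d i != 0].
  by move=> de i [Ei /= ei]; split=> //; apply: contra_neq ei => /de.
transitivity (\sum_(i \in E) (a * c i) *: b i + \sum_(i \in E) c' i *: b i).
  congr (_ + _); rewrite !(fsum_on (X := E `&` [set i | c i != 0])) //.
  - by rewrite scaler_sumr; apply: eq_bigr => i _; rewrite scalerA.
  - move=> i Ei nX; suff ->: c i = 0 by rewrite mulr0 scale0r.
    by apply: contra_notP nX => /eqP.
  - move=> i Ei nX; suff ->: c i = 0 by rewrite scale0r.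
    by apply: contra_notP nX => /eqP.
rewrite -fsumD.
- by apply: eq_fsbigr => i _; rewrite scalerDl.
- apply: sub_finite_set cfin; apply: sub => i ->; by rewrite mulr0 scale0r.
- by apply: sub_finite_set c'fin; apply: sub => i ->; rewrite scale0r.
Qed.

Lemma lincomb_vec (E : set I) (b : I -> V) i : E i ->
  lincomb E b (fun j => (j == i)%:R) (b i).
Proof.
move=> Ei; split.
  apply: (sub_finite_set _ (finite_set1 i)) => j [_ /=].
  by case: (eqVneq j i) => // _; rewrite mulr0n eqxx.
rewrite (@fsum_single _ _ E _ i) ?eqxx ?scale1r // => j _ /eqP/negbTE ->.
by rewrite scale0r.
Qed.

Lemma lincomb_sub (E E' : set I) (b : I -> V) c v : E' `<=` E ->
  lincomb E' b c v -> lincomb E b (fun i => if i \in E' then c i else 0) v.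
Proof.
move=> EE' [cfin ->]; split.
  apply: sub_finite_set cfin => i [_ /=].
  by case: ifP => [/set_mem|_]; rewrite ?eqxx.
transitivity (\sum_(i \in E') (if i \in E' then c i else 0) *: b i).
  by apply: eq_fsbigr => i ->.
apply: fsbig_widen => // i [Ei nE'i] /=; case: ifP => [/set_mem//|_].
by rewrite scale0r.
Qed.

Context {E : set I} {b : I -> V} (bP : is_basis E b).

Lemma basis_ind (P : V -> Prop) : P 0 ->
  (forall a i v, E i -> P v -> P (a *: b i + v)) -> forall v, P v.
Proof.
move=> P0 PD v; have [[c [cfin ->]] _] := bP v.
rewrite (fsum_on (X := E `&` [set i | c i != 0])) //; last first.
  move=> i Ei nX; suff ->: c i = 0 by rewrite scale0r.
  by apply: contra_notP nX => /eqP.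
rewrite big_seq; apply: big_rec => // i w; rewrite in_fset_set; last first.
  exact: finite_setIr.
by move=> /set_mem[Ei _]; apply: PD.
Qed.

Definition coord v : I -> K := sval (cid (bP v).1).

Lemma coordP v : lincomb E b (coord v) v.
Proof. by rewrite /coord; case: cid. Qed.

Lemma coordE c v i : lincomb E b c v -> E i -> coord v i = c i.
Proof. by move=> cv; apply: (bP v).2 (coordP v) cv i. Qed.

Lemma coord_lin a u v i : E i ->
  coord (a *: u + v) i = a * coord u i + coord v i.
Proof.
by apply: (@coordE (fun i => a * coord u i + coord v i));
  apply: lincomb_lin; apply: coordP.
Qed.

Lemma coord_vec i j : E i -> E j -> coord (b i) j = (j == i)%:R.
Proof.
by move=> Ei; apply: (@coordE (fun j => (j == i)%:R)); apply: lincomb_vec.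
Qed.

Lemma coord0 i : E i -> coord 0 i = 0.
Proof.
move=> Ei; have := coord_lin (-1) 0 0 Ei.
by rewrite scaleN1r addNr mulN1r addNr.
Qed.

Lemma coord_inj u v : (forall i, E i -> coord u i = coord v i) -> u = v.
Proof.
move=> uv; rewrite [u](coordP u).2 [v](coordP v).2.
by apply: eq_fsbigr => i /set_mem Ei; rewrite uv.
Qed.

End BasisTheory.

Section DualForms.
Context {K : comNzRingType} {V : lmodType K} {I : choiceType}.
Context {E : set I} {b : I -> V} (bP : is_basis E b).
Implicit Types (c : I -> K) (u v : V) (f g : V -> K).
Implicit Types (F : I -> {linear V -> K^o}).

(** Linear forms as plain functions: the bar operator of the dual module is
defined on functions, and linearity is restored afterwards. *)
Definition is_form f : Prop := forall a u v, f (a *: u + v) = a * f u + f v.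

Lemma form_eq f g : is_form f -> is_form g ->
  (forall i, E i -> f (b i) = g (b i)) -> f =1 g.
Proof.
have form0 h : is_form h -> h 0 = 0.
  by move=> /(_ (-1) 0 0); rewrite scaleN1r addNr mulN1r addNr.
move=> ff fg fgb; apply: (basis_ind bP); first by rewrite !form0.
by move=> a i v Ei fgv; rewrite ff fg fgv fgb.
Qed.

Lemma linear_is_form (f : {linear V -> K^o}) : is_form f.
Proof. by move=> a u v; rewrite linearP. Qed.

(** For a pointwise finite family [F] this is the possibly infinite linear
combination of the forms [F i] with coefficients [c i]. *)
Definition form_sum F c v : K := \sum_(i \in E) c i * F i v.

Lemma form_sum_is_form F c : pointwise_finite E F -> is_form (form_sum F c).
Proof.
move=> Ffin a u v; rewrite /form_sum.
have cfin w d : finite_set (E `&` [set i | d i * F i w != 0]).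
  apply: sub_finite_set (Ffin w) => i [Ei /= cF]; split=> //=.
  by apply: contra_neq cF => ->; rewrite mulr0.
transitivity (\sum_(i \in E) ((a * c i) * F i u + c i * F i v)).
  apply: eq_fsbigr => i _; rewrite linearP /= mulrDr; congr (_ + _).
  by rewrite mulrCA mulrA.
rewrite fsumD //; congr (_ + _).
rewrite !(fsum_on (X := E `&` [set i | F i u != 0])) //.
- by rewrite mulr_sumr; apply: eq_bigr => i _; rewrite mulrA.
- move=> i Ei nX; suff ->: F i u = 0 by rewrite mulr0.
  by apply: contra_notP nX => /eqP.
- move=> i Ei nX; suff ->: F i u = 0 by rewrite mulr0.
  by apply: contra_notP nX => /eqP.
Qed.

Lemma form_sum_linear F c : pointwise_finite E F ->
  exists f : {linear V -> K^o}, f =1 form_sum F c.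
Proof.
move=> Ffin; have flin : linear (form_sum F c : V -> K^o).
  exact: form_sum_is_form.
pose f : {linear V -> K^o} := HB.pack (form_sum F c : V -> K^o)
  (GRing.isLinear.Build _ _ _ _ _ flin).
by exists f.
Qed.

Context {hat : I -> {linear V -> K^o}}.
Hypothesis hatP : forall i j, E i -> E j -> hat i (b j) = (i == j)%:R.

Lemma hat_coord v i : E i -> hat i v = coord bP v i.
Proof.
move=> Ei; apply: (form_eq _ (g := fun v => coord bP v i)).
- exact: linear_is_form.
- by move=> a u w; apply: coord_lin.
- by move=> j Ej; rewrite hatP // coord_vec.
Qed.

Lemma hat_lincomb c v i : lincomb E b c v -> E i -> hat i v = c i.
Proof. by move=> cv Ei; rewrite hat_coord // (coordE bP cv). Qed.

Lemma hat_pointwise_finite : pointwise_finite E hat.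
Proof.
move=> v; apply: sub_finite_set (coordP bP v).1 => i [Ei /=].
by rewrite hat_coord.
Qed.

Lemma form_sum_hat c i : E i -> form_sum hat c (b i) = c i.
Proof.
move=> Ei; rewrite /form_sum (fsum_single Ei).
  by rewrite hatP // eqxx mulr1.
by move=> j Ej /eqP/negbTE ji; rewrite hatP // ji mulr0.
Qed.

Lemma form_expand f v : is_form f ->
  f v = form_sum hat (fun i => f (b i)) v.
Proof.
move=> ff; apply: form_eq => // [|i Ei]; last by rewrite form_sum_hat.
exact/form_sum_is_form/hat_pointwise_finite.
Qed.

End DualForms.

(** * The bar involution of the group algebra *)

Section GroupAlgebraBar.
Context {G : porderZmodType} (hG : ordered_group G).
Context {K : comNzRingType} (hK : forall k : K, k + k = 0 -> k = 0).
Context {A : comAlgType K} {q : G -> A} (hA : is_group_algebra q).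
Context {barA : {linear A -> A}} (hbarA : is_group_algebra_bar q barA).
Implicit Types (g h : G) (a p : A).

Lemma ord_opp_gt0 g : (0 < - g) = (g < 0).
Proof.
have le_opp (x : G) : 0 <= x -> - x <= 0.
  by move/(hG.2 _ _ (- x)); rewrite addr0 addNr.
have le_opp' (x : G) : x <= 0 -> 0 <= - x.
  by move/(hG.2 _ _ (- x)); rewrite addr0 addNr.
rewrite !lt_def oppr_eq0 eq_sym; congr (_ && _).
by apply/idP/idP => [/le_opp|/le_opp' //]; rewrite opprK.
Qed.

Lemma ord_opp_lt0 g : (- g < 0) = (0 < g).
Proof. by rewrite -ord_opp_gt0 opprK. Qed.

Lemma ord_trichotomy g : [\/ g = 0, 0 < g | g < 0].
Proof.
have [->|g0] := eqVneq g 0; first by constructor 1.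
case/orP: (hG.1 0 g) => gle; [constructor 2|constructor 3].
  by rewrite lt_def g0.
by rewrite lt_def eq_sym g0.
Qed.

Lemma bar_mul : {morph barA : a b / a * b}.
Proof.
move=> a b; elim/(basis_ind (ga_basis hA)): a => [|k g a _ IHa].
  by rewrite mul0r linear0 mul0r.
rewrite mulrDl !linearD IHa mulrDl -scalerAl !linearZ /= -scalerAl.
congr (_ *: _ + _); elim/(basis_ind (ga_basis hA)): b {IHa} => [|l h b _ IHb].
  by rewrite mulr0 linear0 mulr0.
rewrite mulrDr !linearD IHb mulrDr -scalerAr !linearZ /= -scalerAr.
by rewrite -(ga_mul hA) !hbarA opprD (ga_mul hA).
Qed.

Lemma bar_invol : involutive barA.
Proof.
elim/(basis_ind (ga_basis hA)) => [|k g a _ IHa]; first by rewrite !linear0.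
by rewrite !linearD !linearZ /= IHa !hbarA opprK.
Qed.

Lemma bar1 : barA 1 = 1.
Proof. by rewrite -(ga_one hA) hbarA oppr0. Qed.

Definition coef a g : K := coord (ga_basis hA) a g.

Lemma coef_lin k a b g : coef (k *: a + b) g = k * coef a g + coef b g.
Proof. exact: coord_lin. Qed.

Lemma coefN a g : coef (- a) g = - coef a g.
Proof.
have := coef_lin (-1) a 0 g; rewrite addr0 scaleN1r => ->.
by rewrite /coef (coord0 (ga_basis hA) (i := g)) // addr0 mulN1r.
Qed.

Lemma coefB a b g : coef (a - b) g = coef a g - coef b g.
Proof. by rewrite -{1}[a]scale1r coef_lin coefN mul1r. Qed.

Lemma coef_bar a g : coef (barA a) g = coef a (- g).
Proof.
elim/(basis_ind (ga_basis hA)): a => [|k h a _ IHa].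
  by rewrite linear0 /coef !coord0.
rewrite linearD linearZ /= hbarA !coef_lin IHa; congr (_ * _ + _).
by rewrite /coef !coord_vec // (inv_eq (@opprK G)).
Qed.

Lemma coef_inj a b : coef a =1 coef b -> a = b.
Proof.
by move=> ab; apply: (coord_inj (bP := ga_basis hA)) => g _; apply: ab.
Qed.

Lemma coef_ge0 a g : A_ge0 q a -> g < 0 -> coef a g = 0.
Proof.
case=> c /(lincomb_sub (E := setT) (@subsetT _ _)) cE g0.
rewrite /coef (coordE (ga_basis hA) cE) //.
by case: ifP => // /set_mem /= /(lt_le_trans g0); rewrite ltxx.
Qed.

Lemma coef_const a : zero_const_term q a -> coef a 0 = 0.
Proof. by case=> c [cE c0]; rewrite /coef (coordE (ga_basis hA) cE). Qed.

Lemma A_gt0_ge0 a : A_gt0 q a -> A_ge0 q a.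
Proof.
case=> c cE; eexists; apply: lincomb_sub cE.
by move=> g /= /ltW.
Qed.

Lemma A_gt0_const a : A_gt0 q a -> zero_const_term q a.
Proof.
case=> c cE; eexists; split; first exact: lincomb_sub (@subsetT _ _) cE.
by rewrite /=; case: ifP => // /set_mem /=; rewrite ltxx.
Qed.

Lemma A_ge0_1 : A_ge0 q 1.
Proof.
by rewrite -(ga_one hA); eexists; apply: lincomb_vec => /=; apply: lexx.
Qed.

Lemma A_ge0_0 : A_ge0 q 0.
Proof.
exists (fun=> 0); split.
  by apply: sub_finite_set (finite_set0 G) => g [_ /=]; rewrite eqxx.
by rewrite fsbig1 // => g _; rewrite scale0r.
Qed.

Lemma zero_const_0 : zero_const_term q 0.
Proof.
exists (coord (ga_basis hA) 0); split; first exact: coordP.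
by rewrite coord0.
Qed.

(** Bar exchanges the coefficients at [g] and [- g], so an anti-invariant [a] is
recovered from its part [p] in positive degrees.  Its constant term [k]
satisfies [k = - k], and vanishes because the scalars have no 2-torsion. *)
Lemma bar_defect_solve a : barA a = - a ->
  exists p, A_gt0 q p /\ p - barA p = a.
Proof.
move=> abar; have coefa g : coef a (- g) = - coef a g.
  by rewrite -coef_bar abar coefN.
have a0 : coef a 0 = 0.
  by apply: hK; rewrite -{2}[coef a 0]opprK -coefa oppr0 subrr.
have afin : finite_set ([set g | 0 < g] `&` [set g | coef a g != 0]).
  apply: sub_finite_set (coordP (ga_basis hA) a).1 => g [_ /= ag].
  by split.
pose p := \sum_(g \in [set g | 0 < g]) coef a g *: q g.
have pE : lincomb [set g | 0 < g] q (coef a) p by [].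
exists p; split; first by exists (coef a).
have coefp g : coef p g = if 0 < g then coef a g else 0.
  rewrite /coef.
  rewrite (coordE (ga_basis hA) (lincomb_sub (E := setT) (@subsetT _ _) pE)) //.
  by rewrite (_ : (g \in _) = (0 < g)) //; apply/idP/idP => [/set_mem|/mem_set].
apply: coef_inj => g; rewrite coefB coef_bar !coefp ord_opp_gt0.
case: (ord_trichotomy g) => [->|g0|g0].
- by rewrite ltxx a0 subrr.
- by rewrite g0 lt_gtF // subr0.
- by rewrite g0 lt_gtF // sub0r coefa opprK.
Qed.

(** In positive degrees [p] and [p - barA p] have the same coefficients, since
[barA p] lives in degrees at most [0]. *)
Lemma bar_defect_inj p p' : A_ge0 q p -> A_ge0 q p' ->
  zero_const_term q p -> zero_const_term q p' ->
  p - barA p = p' - barA p' -> p = p'.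
Proof.
have coefgt a g : A_ge0 q a -> 0 < g -> coef (a - barA a) g = coef a g.
  move=> a0 g0; rewrite coefB coef_bar (coef_ge0 (g := - g) a0) ?subr0 //.
  by rewrite ord_opp_lt0.
move=> p0 p'0 pc p'c pp'; apply: coef_inj => g.
case: (ord_trichotomy g) => [->|g0|g0].
- by rewrite !coef_const.
- by rewrite -coefgt // pp' coefgt.
- by rewrite !coef_ge0.
Qed.

End GroupAlgebraBar.

(** * Families unitriangular for the Bruhat order *)

(** Iterating [F] stabilizes at [y] after [(rk y).+1] steps. *)
Lemma rank_recursion (I : Type) (rk : I -> nat) (B : Type) (b0 : B)
    (F : (I -> B) -> I -> B) :
  (forall f g y, (forall x, (rk x < rk y)%N -> f x = g x) -> F f y = F g y) ->
  exists f, forall y, f y = F f y.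
Proof.
move=> Floc; pose f n := iter n F (fun=> b0).
have stable n m y : (rk y < n)%N -> (rk y < m)%N -> f n y = f m y.
  elim: n m y => [//|n IHn] [//|m] y; rewrite !ltnS => yn ym.
  by apply: Floc => x xy; apply: IHn; apply: leq_trans xy _.
exists (fun y => f (rk y).+1 y) => y.
by apply: Floc => x xy; apply: stable.
Qed.

Section Unitriangular.
Context {W : groupType} {S : set W} (hS : coxeter_system S).
Context {A : comNzRingType} (E : set W).
Implicit Types (N : W -> W -> A) (c : W -> A).

Definition unitriangular N : Prop :=
  (forall x y, E x -> E y -> ~ bruhat_le S x y -> N x y = 0) /\
  (forall y, E y -> N y y = 1).

Lemma below_finite y : finite_set (E `&` [set x | bruhat_lt S x y]).
Proof.
by apply: sub_finite_set (bruhat_lower_finite hS y) => x [_ []].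
Qed.

Lemma unitriangular_sum N c y : unitriangular N -> E y ->
  \sum_(x \in E) c x * N x y =
    c y + \sum_(x \in E `&` [set x | bruhat_lt S x y]) c x * N x y.
Proof.
case=> N0 N1 Ey; set B := E `&` [set x | bruhat_le S x y].
have Bfin : finite_set B.
  by apply: sub_finite_set (bruhat_lower_finite hS y) => x [].
have <- : \sum_(x \in B) c x * N x y = \sum_(x \in E) c x * N x y.
  apply: fsbig_widen => [x []//|x [Ex nB] /=].
  by rewrite N0 ?mulr0 // => xy; apply: nB.
rewrite (fsbigD1 y) //; last by split=> //; apply: bruhat_refl.
rewrite N1 // mulr1; congr (_ + _); apply: eq_fsbigl; apply/seteqP.
split=> x; first by move=> [[Ex xy] /= xney].
by move=> [Ex [xy xney]].
Qed.

Context {V : lmodType A} {b : W -> V} (bP : is_basis E b).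
Context {hat : W -> {linear V -> A^o}}.
Hypothesis hatP : forall i j, E i -> E j -> hat i (b j) = (i == j)%:R.

(** [D z] vanishes at [b y] unless [z] lies below [y], and [y] has finitely many
elements below it. *)
Lemma unitriangular_pointwise_finite (D : W -> {linear V -> A^o}) :
  unitriangular (fun z y => D z (b y)) -> pointwise_finite E D.
Proof.
move=> [D0 _] v.
apply: (@sub_finite_set _ _ (\bigcup_(y in E `&` [set y | hat y v != 0])
    [set z | bruhat_le S z y])); last first.
  apply: bigcup_finite; first exact: hat_pointwise_finite.
  by move=> y _; apply: bruhat_lower_finite.
move=> z [Ez /=]; rewrite (form_expand bP hatP _ (linear_is_form (D z))).
move=> /eqP/fsum_neq0[y Ey Dy]; exists y.
  by split=> //=; apply: contra_notN Dy => /eqP ->; rewrite mulr0.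
by apply: contra_notP Dy => /(D0 _ _ Ez Ey) ->; rewrite mul0r.
Qed.

(** The coefficients of a form on the [D z] solve a unitriangular system, by
recursion on the length: the equation at [y] involves the finitely many
coefficients below [y] only. *)
Lemma unitriangular_dual_basis (D : W -> {linear V -> A^o}) :
  unitriangular (fun z y => D z (b y)) -> is_dual_basis E D.
Proof.
move=> Dtri; have Dfin := unitriangular_pointwise_finite Dtri.
split=> // f; split.
  (* The value of [f] at [b y] minus the contribution of smaller indices. *)
  pose F c y := f (b y) -
    \sum_(z \in E `&` [set z | bruhat_lt S z y]) c z * D z (b y).
  have [|c cE] := @rank_recursion W (len S) A 0 F.
    move=> c c' y cc'; congr (_ - _); apply: eq_fsbigr => z /set_mem[_ zy].
    by rewrite cc' //; apply: bruhat_lt_len zy.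
  exists c; split=> //; apply: form_eq => //; first exact: linear_is_form.
    exact: form_sum_is_form.
  move=> y Ey.
  by rewrite /form_sum (unitriangular_sum c Dtri Ey) {1}cE /F addrNK.
move=> c c' [_ cf] [_ c'f].
have cb d : (forall v, f v = \sum_(i \in E) d i * D i v) -> forall y, E y ->
    d y = f (b y) -
      \sum_(z \in E `&` [set z | bruhat_lt S z y]) d z * D z (b y).
  by move=> df y Ey; rewrite df (unitriangular_sum d Dtri Ey) addrK.
move=> y; have [n] := ubnP (len S y); elim: n y => // n IHn y yn Ey.
rewrite (cb _ cf) // (cb _ c'f) //; congr (_ - _).
apply: eq_fsbigr => z /set_mem[Ez /bruhat_lt_len zy].
by rewrite IHn // (leq_trans zy).
Qed.

End Unitriangular.

(** * The module of a W-graph ideal and its dual *)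

Section HeckeAction.
Context {A : comNzRingType} {H : algType A} {M : lmodType H}.
Implicit Types (h : H) (a : A) (m : base_mod M).

Lemma base_modZ a m : a *: m = (a%:A : H) *: (m : M).
Proof. by []. Qed.

Lemma hact_lin h a m m' : hact h (a *: m + m') = a *: hact h m + hact h m'.
Proof.
rewrite /hact base_modZ [LHS]scalerDr scalerA base_modZ scalerA.
by rewrite mulr_algr mulr_algl.
Qed.

Lemma hact_sub_scalar h a m : hact (h - a%:A) m = hact h m - a *: m.
Proof. exact: (scalerBl h (a%:A) (m : M)). Qed.

End HeckeAction.

Section WGraphModule.
Context {W : groupType} {S : set W} (hS : coxeter_system S).
Context {G : porderZmodType} (hG : ordered_group G) {L : W -> G}.
Context {K : comNzRingType} (hK : forall k : K, k + k = 0 -> k = 0).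
Context {A : comAlgType K} {q : G -> A} (hA : is_group_algebra q).
Context {barA : {linear A -> A}} (hbarA : is_group_algebra_bar q barA).
Context {H : algType A} {T : W -> H} (hH : is_hecke_algebra S L q T).
Context {barH : H -> H} (hbarH : is_hecke_bar barA T barH).
Context {J E : set W} {M : lmodType H}.
Context {Gam : W -> base_mod M} {barM : base_mod M -> base_mod M}.
Hypothesis E_neq0 : E !=set0.
Hypothesis E_ideal : left_weak_ideal S E.
Hypothesis hE : wgraph_ideal_module S J E L q T barA barH Gam barM.
Context {Rm : W -> W -> A}.
Hypothesis hRm : forall y, E y -> lincomb E Gam (Rm^~ y) (barM (Gam y)).
Context {hat : W -> {linear base_mod M -> A^o}}.
Hypothesis hatP : forall z w, E z -> E w -> hat z (Gam w) = (z == w)%:R.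
Implicit Types (s w x y z : W) (f : base_mod M -> A).

Let bP := wg_basis hE.

(** The quadratic relation gives the inverse of [T s], which is its bar image. *)
Lemma hecke_bar_gen s : S s ->
  barH (T s) = T s - (q (L s) - q (- L s))%:A.
Proof.
move=> Ss; set c := q (L s) - q (- L s).
have ss : (s * s = 1)%g by have := genK hS 1%g Ss; rewrite mulg1.
have TsK : T s * (T s - c%:A) = 1.
  rewrite mulrBr mulr_algr (hecke_down hH) //.
    by rewrite ss (hecke_one hH) addrK.
  by rewrite ss (len1 hS) (len_gen hS Ss).
have [barTs _] := hbarH.2 s; rewrite (gen_inv hS Ss) in barTs.
by have := congr1 ( *%R (barH (T s))) TsK; rewrite mulrA barTs mul1r mulr1.
Qed.

Lemma ideal_left_descent s w : S s -> E w -> (len S (s * w)%g < len S w)%N ->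
  E (s * w)%g.
Proof.
move=> Ss Ew sw; apply: E_ideal Ew; exists s.
rewrite (genK hS) // (len_gen hS Ss) add1n; split=> //.
by apply/eqP; rewrite eqn_leq sw andbT -{1}(genK hS w Ss) (len_mull hS).
Qed.

Lemma ideal_one : E 1%g.
Proof.
case: E_neq0 => w; have [n] := ubnP (len S w); elim: n w => // n IHn w wn Ew.
have [<-//|/eqP w1] := eqVneq w 1%g.
have [s Ss sw] := left_descent_ex hS w1.
by apply: (IHn (s * w)%g); [exact: leq_trans sw wn|exact: ideal_left_descent].
Qed.

(** In each of the four cases of the action, [T s] sends [Gam w] into the span of
the basis elements below [w], up to the one new basis element indexed by
[s w] when [s w] belongs to the ideal. *)
Lemma hecke_act_below s w : S s -> E w -> exists u : base_mod M,
  (forall x, E x -> ~ bruhat_le S x w -> hat x u = 0) /\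
  hact (T s) (Gam w) = u + (if (s * w)%g \in E then Gam (s * w)%g else 0).
Proof.
move=> Ss Ew.
have belowZ a x : E x -> ~ bruhat_le S x w -> hat x (a *: Gam w) = 0.
  move=> Ex xw; rewrite linearZ /= hatP //.
  by case: eqVneq xw => [->|_ _]; [case; apply: bruhat_refl|apply: mulr0].
have [sw|ws] := len_gen_total hS w Ss.
  have Esw := ideal_left_descent Ss Ew sw.
  exists ((q (L s) - q (- L s)) *: Gam w).
  split; first by move=> x; apply: belowZ.
  by rewrite mem_set // (wg_minus hE) // addrC.
have [Esw|nEsw] := pselect (E (s * w)%g).
  exists 0; split=> [x _ _|]; first by rewrite linear0.
  by rewrite mem_set // add0r (wg_plus hE).
rewrite memNset //.
have [Dsw|nDsw] := pselect (coset_reps S J (s * w)%g); last first.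
  exists (- q (- L s) *: Gam w); split; first by move=> x; apply: belowZ.
  by rewrite addr0 (wg_zero_minus hE) // scaleNr.
have [//|r [_ rE]] := wg_zero_plus hE (w := w) Ss.
eexists; split; last by rewrite rE addr0.
move=> x Ex xw; set u := \sum_(z \in _) _.
have uE : lincomb (E `&` [set z | bruhat_lt S z w]) Gam r u.
  by split=> //; apply: finite_setIl; apply: below_finite.
rewrite linearB linearZ /= hatP //.
rewrite (hat_lincomb bP hatP (lincomb_sub (@subIsetl _ _ _) uE)) //.
case: eqVneq xw => [->|_ xw]; first by case; apply: bruhat_refl.
by case: ifP => [/set_mem[_ [/xw]]|_] //; rewrite mulr0n scaler0 subr0.
Qed.

Lemma hecke_act_above s w y x : S s -> E w -> E x -> bruhat_le S w y ->
  (len S y < len S (s * y)%g)%N -> ~ bruhat_le S x (s * y)%g ->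
  hat x (hact (T s) (Gam w)) = 0.
Proof.
move=> Ss Ew Ex wy ysy xsy; have [u [uE ->]] := hecke_act_below Ss Ew.
have ysyB := (bruhat_gen Ss ysy).1.
rewrite linearD /= uE //; last first.
  by move=> xw; apply/xsy/bruhat_trans/ysyB/bruhat_trans/wy.
case: ifP => [/set_mem Esw|_]; last by rewrite linear0 addr0.
rewrite hatP // add0r; case: eqVneq => // xE.
by case: xsy; rewrite xE; apply: (bruhat_lift hS).
Qed.

Lemma hecke_act_top s w y : S s -> E w -> E (s * y)%g -> bruhat_le S w y ->
  (len S y < len S (s * y)%g)%N ->
  hat (s * y)%g (hact (T s) (Gam w)) = (w == y)%:R.
Proof.
move=> Ss Ew Esy wy ysy; have [u [uE ->]] := hecke_act_below Ss Ew.
rewrite linearD /= uE //; last first.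
  move=> /bruhat_trans/(_ wy)/bruhat_len[syy|]; last by rewrite ltnNge ltnW.
  by rewrite syy ltnn in ysy.
rewrite add0r; have [wy_eq|wy_neq] := eqVneq w y.
  by rewrite wy_eq mem_set // hatP // eqxx.
case: ifP => [/set_mem Esw|_]; last by rewrite linear0.
rewrite hatP // (can_eq (mulKg s)) eq_sym; case: eqP wy_neq => //.
Qed.

(** Induction on the length of [y]: with [s] a left descent of [y],
[Gam y = T s (Gam (s y))], so the bar image of [Gam y] is obtained by letting
[T s - (q^L(s) - q^-L(s))] act on that of [Gam (s y)].  By the lifting
property the action only produces indices below [y], and [y] itself only from
the leading term. *)
Lemma bar_unitriangular :
  unitriangular (S := S) E (fun x y => hat x (barM (Gam y))).
Proof.
suff tri y : E y ->
    (forall x, E x -> ~ bruhat_le S x y -> hat x (barM (Gam y)) = 0) /\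
    hat y (barM (Gam y)) = 1.
  by split=> [x y Ex Ey|y Ey]; [apply: (tri y Ey).1|apply: (tri y Ey).2].
have [n] := ubnP (len S y); elim: n y => // n IHn y yn Ey.
have [y1|/eqP y1] := eqVneq y 1%g.
  rewrite y1 (wg_bar_one hE); have E1 := ideal_one.
  split=> [x Ex x1|]; rewrite hatP ?eqxx //.
  by case: eqVneq x1 => // -> []; apply: bruhat_refl.
have [s Ss sy] := left_descent_ex hS y1.
have Esy := ideal_left_descent Ss Ey sy.
have [tri0 tri1] := IHn _ (leq_trans sy yn) Esy.
have ssy : (s * (s * y))%g = y := genK hS y Ss.
have lt_sy : (len S (s * y)%g < len S (s * (s * y))%g)%N by rewrite ssy.
have sy_le : bruhat_le S (s * y)%g y.
  by rewrite -{2}ssy; apply: (bruhat_gen Ss lt_sy).1.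
set v := barM (Gam (s * y)%g).
have -> : barM (Gam y) = hact (T s) v - (q (L s) - q (- L s)) *: v.
  rewrite -{1}ssy -(wg_plus hE (w := (s * y)%g) Ss); last first.
    by split; rewrite ?ssy.
  by rewrite (wg_bar_hact hE) hecke_bar_gen // hact_sub_scalar.
have act x : hat x (hact (T s) v) =
    \sum_(w \in E) hat x (hact (T s) (Gam w)) * hat w v.
  pose f m := hat x (hact (T s) m); rewrite -/(f v).
  apply: (form_expand bP hatP v) => a m m'.
  by rewrite /f hact_lin linearP.
have off x : E x -> ~ bruhat_le S x (s * y)%g -> hat x (hact (T s) v -
    (q (L s) - q (- L s)) *: v) = hat x (hact (T s) v).
  by move=> Ex xsy; rewrite linearB linearZ /= tri0 // scaler0 subr0.
split=> [x Ex xy|].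
  rewrite off //; last by move=> xsy; apply/xy/bruhat_trans/sy_le.
  rewrite act fsbig1 // => w Ew.
  have [wsy|wsy] := pselect (bruhat_le S w (s * y)%g); last first.
    by rewrite tri0 // mulr0.
  by rewrite (hecke_act_above Ss Ew Ex wsy) ?mul0r // ssy.
rewrite off //; last first.
  by move=> /bruhat_len[ysy|]; [rewrite -ysy ltnn in sy|rewrite ltnNge ltnW].
have top w : E w -> bruhat_le S w (s * y)%g ->
    hat y (hact (T s) (Gam w)) = (w == (s * y)%g)%:R.
  move=> Ew wsy; rewrite -{1}ssy; apply: hecke_act_top => //.
  by rewrite ssy.
rewrite act (fsum_single Esy) => [|w Ew wsy].
  by rewrite top ?eqxx ?tri1 ?mulr1 //; apply: bruhat_refl.
have [wle|nwle] := pselect (bruhat_le S w (s * y)%g); last first.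
  by rewrite tri0 // mulr0.
by rewrite top //; case: eqP wsy => // _ _; rewrite mul0r.
Qed.

Lemma hat_bar x y : E x -> E y -> hat x (barM (Gam y)) = Rm x y.
Proof. by move=> Ex Ey; apply: (hat_lincomb bP hatP (hRm Ey)). Qed.

Lemma form_bar f y : is_form f -> E y ->
  f (barM (Gam y)) = f (Gam y) +
    \sum_(x \in E `&` [set x | bruhat_lt S x y]) f (Gam x) * Rm x y.
Proof.
move=> ff Ey; rewrite (form_expand bP hatP _ ff) /form_sum.
rewrite (unitriangular_sum hS (fun x => f (Gam x)) bar_unitriangular Ey).
by congr (_ + _); apply: eq_fsbigr => x /set_mem[Ex _]; rewrite hat_bar.
Qed.

Let dbar := dual_bar barA barM.

Lemma dual_bar_form f : is_form f -> is_form (dbar f).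
Proof.
move=> ff a u v; rewrite /dbar /dual_bar (wg_bar_semilinear hE) ff.
by rewrite linearD /= (bar_mul hA hbarA) (bar_invol hA hbarA).
Qed.

Lemma dual_bar_vec f y : is_form f -> E y ->
  dbar f (Gam y) = barA (f (Gam y)) +
    \sum_(x \in E `&` [set x | bruhat_lt S x y])
      barA (f (Gam x)) * barA (Rm x y).
Proof.
move=> ff Ey; rewrite /dbar /dual_bar form_bar // linearD /=; congr (_ + _).
rewrite !fsbig_finite ?linear_sum; try exact: below_finite.
by apply: eq_bigr => x _; rewrite -(bar_mul hA hbarA).
Qed.

(** The difference [g] of the bar image of [f] and [f] is negated by the bar
operator.  If it vanishes below [y], then [g (barM (Gam y)) = g (Gam y)] by
unitriangularity, so the value of [g] at [Gam y] is anti-invariant.  This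
replaces the usual computation with the product of the matrix [Rm] and its
conjugate. *)
Lemma dual_bar_defect f y : is_form f -> E y ->
  (forall x, E x -> bruhat_lt S x y -> dbar f (Gam x) = f (Gam x)) ->
  barA (dbar f (Gam y) - f (Gam y)) = - (dbar f (Gam y) - f (Gam y)).
Proof.
move=> ff Ey below; pose g v := dbar f v - f v.
have gf : is_form g.
  move=> a u v; rewrite /g (dual_bar_form ff) ff mulrBr.
  by rewrite opprD addrACA.
have gbar : g (barM (Gam y)) = g (Gam y).
  rewrite form_bar // fsbig1 ?addr0 // => x [Ex xy].
  by rewrite /g below // subrr mul0r.
rewrite -/(g (Gam y)) -{1}gbar /g linearB /= /dbar /dual_bar.
by rewrite (wg_bar_invol hE) (bar_invol hA hbarA) opprB.
Qed.

Definition KL_tail (Q : W -> A) z y : A :=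
  \sum_(x \in E `&` [set x | bruhat_le S z x /\ bruhat_lt S x y])
    barA (Q x) * barA (Rm x y).

(** For the entries off the diagonal, lying in positive degrees combines
nonnegativity with the vanishing of the constant term. *)
Definition KL_row z (Q : W -> A) : Prop :=
  [/\ forall y, E y -> ~ bruhat_le S z y -> Q y = 0,
      Q z = 1,
      forall y, E y -> bruhat_lt S z y -> A_gt0 q (Q y) &
      forall y, E y -> bruhat_lt S z y -> Q y - barA (Q y) = KL_tail Q z y].

Lemma KL_tail0 Q z y : z = y \/ ~ bruhat_le S z y -> KL_tail Q z y = 0.
Proof.
move=> zy; rewrite /KL_tail fsbig1 // => x [_ /= [zx xy]]; exfalso.
case: zy => [E0|]; last by apply; apply: bruhat_trans zx xy.1.
rewrite -E0 in xy; case: (bruhat_len zx) => [xz|]; first by case: xy => _ [].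
by rewrite ltnNge ltnW ?bruhat_lt_len.
Qed.

Lemma dual_bar_KL_row z Q f y : E z -> is_form f ->
  (forall x, E x -> f (Gam x) = Q x) ->
  (forall x, E x -> ~ bruhat_le S z x -> Q x = 0) -> E y ->
  dbar f (Gam y) = barA (Q y) + KL_tail Q z y.
Proof.
move=> Ez ff fQ Q0 Ey; rewrite dual_bar_vec // fQ //; congr (_ + _).
transitivity (\sum_(x \in E `&` [set x | bruhat_lt S x y])
    barA (Q x) * barA (Rm x y)).
  by apply: eq_fsbigr => x /set_mem[Ex _]; rewrite fQ.
apply/esym/fsbig_widen => [x [Ex [zx xy]]//|x [[Ex xy] nzx] /=].
by rewrite Q0 ?linear0 ?mul0r // => zx; apply: nzx.
Qed.

(** The recursion at [y] says that the form with values [Q] and its bar image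
agree at [Gam y]. *)
Lemma KL_rec_bar_fixed z Q f y : E z -> is_form f ->
  (forall x, E x -> f (Gam x) = Q x) ->
  (forall x, E x -> ~ bruhat_le S z x -> Q x = 0) -> Q z = 1 -> E y ->
  (bruhat_lt S z y -> Q y - barA (Q y) = KL_tail Q z y) ->
  dbar f (Gam y) = f (Gam y).
Proof.
move=> Ez ff fQ Q0 Q1 Ey Qrec.
rewrite (dual_bar_KL_row Ez ff fQ Q0 Ey) fQ //.
have [->|/eqP yz] := eqVneq y z.
  by rewrite Q1 (bar1 hA hbarA) KL_tail0 ?addr0; last by left.
have [zy|nzy] := pselect (bruhat_le S z y); last first.
  by rewrite Q0 // linear0 KL_tail0 ?addr0; last by right.
have zlty : bruhat_lt S z y by split=> // /esym.
by rewrite -(Qrec zlty) addrC subrK.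
Qed.

(** [Q] is defined by recursion on the length: at [y] above [z] it is the
positive solution of [p - barA p = a], where [a] is the sum over the smaller
indices.  The equation is solvable because [a] and the defect at [Gam y] of the form
with values [Q] differ by the anti-invariant [Q y - barA (Q y)]. *)
Lemma KL_row_exists z : E z -> exists Q, KL_row z Q.
Proof.
move=> Ez.
(* A solution operator, with an arbitrary value where no solution exists. *)
have /choice[sol solP] a : exists p, barA a = - a ->
    A_gt0 q p /\ p - barA p = a.
  have [abar|] := pselect (barA a = - a); last by exists 0.
  by have [p pP] := bar_defect_solve hG hK hA hbarA abar; exists p.
pose F (Q : W -> A) y := if y == z then 1 else
  if `[< bruhat_le S z y >] then sol (KL_tail Q z y) else 0.
have [|Q QE] := @rank_recursion W (len S) A 0 F.
  move=> Q Q' y QQ'; rewrite /F.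
  congr (if _ then _ else if _ then sol _ else _).
  by apply: eq_fsbigr => x /set_mem[_ [_ /bruhat_lt_len xy]]; rewrite QQ'.
have Q1 : Q z = 1 by rewrite QE /F eqxx.
have Q0 y : E y -> ~ bruhat_le S z y -> Q y = 0.
  move=> Ey zy; rewrite QE /F; case: eqVneq zy => [->[]|_ zy].
    exact: bruhat_refl.
  by rewrite asboolF.
have Qsol y : bruhat_lt S z y -> Q y = sol (KL_tail Q z y).
  by case=> zy /eqP/negbTE zny; rewrite {1}QE /F eq_sym zny asboolT.
have [f fE] := form_sum_linear Q (hat_pointwise_finite bP hatP).
have ff := linear_is_form f.
have fQ x : E x -> f (Gam x) = Q x by move=> Ex; rewrite fE form_sum_hat.
have solvable y : E y -> bruhat_lt S z y ->
    barA (KL_tail Q z y) = - KL_tail Q z y.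
  have [n] := ubnP (len S y); elim: n y => // n IHn y yn Ey zy.
  have := @dual_bar_defect f y ff Ey; rewrite fQ //.
  rewrite (dual_bar_KL_row Ez ff fQ Q0 Ey) => defect.
  have /defect {}defect x : E x -> bruhat_lt S x y ->
      dbar f (Gam x) = f (Gam x).
    move=> Ex /bruhat_lt_len xy; apply: (KL_rec_bar_fixed Ez ff fQ Q0 Q1 Ex).
    move=> zx; rewrite (Qsol x zx).
    exact: (solP _ (IHn x (leq_trans xy yn) Ex zx)).2.
  move: defect; rewrite linearB linearD /= (bar_invol hA hbarA).
  set t := KL_tail _ _ _ => defect.
  have -> : barA t = (Q y + barA t - barA (Q y)) - Q y + barA (Q y) by ring.
  by rewrite defect; ring.
exists Q; split=> // y Ey zy; rewrite (Qsol y zy).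
  exact: (solP _ (solvable y Ey zy)).1.
exact: (solP _ (solvable y Ey zy)).2.
Qed.

Lemma dual_KL_basis_values D Q z y :
  dual_KL_basis S E q barA barM Rm hat D Q -> E z -> E y ->
  D z (Gam y) = Q z y.
Proof.
move=> /dkl_expand DQ Ez Ey; have [_ ->] := DQ z Ez.
exact: (form_sum_hat hatP).
Qed.

(** Induction on the length of [y] shows that two solutions have the same matrix
[Q]: the recursion determines [Q z y - barA (Q z y)] from smaller indices,
hence [Q z y]. *)
Lemma dual_KL_basis_unique D Q D' Q' :
  dual_KL_basis S E q barA barM Rm hat D Q ->
  dual_KL_basis S E q barA barM Rm hat D' Q' ->
  forall z, E z -> D' z =1 D z.
Proof.
move=> DQ D'Q' z Ez; apply: (form_eq bP); try exact: linear_is_form.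
move=> y Ey.
rewrite (dual_KL_basis_values D'Q') // (dual_KL_basis_values DQ) //.
have [n] := ubnP (len S y); elim: n y Ey => // n IHn y Ey yn.
have [<-|/eqP zy] := eqVneq z y.
  by rewrite (dkl_diag DQ) ?(dkl_diag D'Q').
have [zley|nzy] := pselect (bruhat_le S z y); last first.
  by rewrite (dkl_supp DQ) ?(dkl_supp D'Q').
apply: (bar_defect_inj hG hA hbarA).
- exact: dkl_ge0 D'Q' _ _ _ _.
- exact: dkl_ge0 DQ _ _ _ _.
- exact: dkl_const D'Q' _ _ _ _ _.
- exact: dkl_const DQ _ _ _ _ _.
rewrite (dkl_rec DQ) // (dkl_rec D'Q') //; apply: eq_fsbigr.
move=> x /set_mem[Ex [_ /bruhat_lt_len xy]].
by rewrite IHn // (leq_trans xy).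
Qed.

Lemma dual_KL_basis_exists :
  exists D Q, dual_KL_basis S E q barA barM Rm hat D Q.
Proof.
have /choice[Q QP] z : exists Q, E z -> KL_row z Q.
  have [/KL_row_exists[Q QP]|] := pselect (E z); first by exists Q.
  by exists (fun=> 0).
have hatfin := hat_pointwise_finite bP hatP.
have /choice[D DE] z := form_sum_linear (Q z) hatfin.
have DQ z y : E y -> D z (Gam y) = Q z y.
  by move=> Ey; rewrite DE form_sum_hat.
have Dtri : unitriangular (S := S) E (fun z y => D z (Gam y)).
  split=> [z y Ez Ey zy|z Ez]; rewrite DQ //; case: (QP z Ez) => Q0 Q1 _ _ //.
  exact: Q0.
exists D, Q; split.
- exact: (unitriangular_dual_basis hS bP hatP Dtri).
- move=> z Ez; case: (QP z Ez) => Q0 Q1 _ Qrec.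
  have Dform := linear_is_form (D z).
  apply: (form_eq bP) => //; first exact: dual_bar_form.
  move=> y Ey; apply: (KL_rec_bar_fixed Ez Dform (DQ z) Q0 Q1 Ey).
  exact: Qrec.
- by move=> z Ez; split=> // v; apply: DE.
- move=> z y Ez Ey; case: (QP z Ez) => Q0 Q1 Qgt _.
  have [<-|/eqP zy] := eqVneq z y; first by rewrite Q1; apply: A_ge0_1 hA.
  have [zley|nzy] := pselect (bruhat_le S z y).
    exact/A_gt0_ge0/Qgt.
  by rewrite Q0 //; apply: A_ge0_0.
- by move=> z y Ez; case: (QP z Ez) => Q0 _ _ _; apply: Q0.
- by move=> z Ez; case: (QP z Ez).
- move=> z y Ez Ey zy; case: (QP z Ez) => Q0 Q1 Qgt _.
  have [zley|nzy] := pselect (bruhat_le S z y).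
    exact/A_gt0_const/Qgt.
  by rewrite Q0 //; apply: zero_const_0 hA.
by move=> z y Ez Ey zy; case: (QP z Ez) => _ _ _; apply.
Qed.

End WGraphModule.

Theorem theorem4p3
  (W : groupType) (S : set W) (hS : coxeter_system S)
  (G : porderZmodType) (hG : ordered_group G)
  (L : W -> G) (hL : weight_function S L) (hL0 : forall s, S s -> 0 <= L s)
  (* K is a subring of the complex numbers and A = K[G] *)
  (RR : realType) (K : comNzRingType) (iota : {rmorphism K -> RR[i]})
  (hiota : injective iota)
  (A : comAlgType K) (q : G -> A) (hA : is_group_algebra q)
  (barA : {linear A -> A}) (hbarA : is_group_algebra_bar q barA)
  (H : algType A) (T : W -> H) (hH : is_hecke_algebra S L q T)
  (barH : H -> H) (hbarH : is_hecke_bar barA T barH)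
  (J E : set W)
  (M : lmodType H) (Gam : W -> base_mod M) (barM : base_mod M -> base_mod M)
  (hE : wgraph_ideal S J E L q T barA barH Gam barM)
  (Rm : W -> W -> A)
  (hRm : forall y, E y -> lincomb E Gam (Rm^~ y) (barM (Gam y)))
  (hatGam : W -> {linear base_mod M -> A^o})
  (hhat : forall z w, E z -> E w -> hatGam z (Gam w) = (z == w)%:R) :
  exists D : W -> {linear base_mod M -> A^o},
    (exists Q, dual_KL_basis S E q barA barM Rm hatGam D Q) /\
    (forall D' Q', dual_KL_basis S E q barA barM Rm hatGam D' Q' ->
       forall z, E z -> D' z =1 D z).
Proof.
(* A subring of the complex numbers has characteristic 0. *)
have hK (k : K) : k + k = 0 -> k = 0.
  move=> kk; apply: hiota; rewrite rmorph0; apply/eqP.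
  by have := mulrn_eq0 (iota k) 2; rewrite mulr2n -rmorphD kk rmorph0 eqxx.
case: hE => _ E0 Eideal _ hM.
have [D [Q DQ]] := dual_KL_basis_exists hS hG hK hA hbarA hH hbarH E0 Eideal
  hM hRm hhat.
exists D; split; first by exists Q.
move=> D' Q' D'Q'; exact: (dual_KL_basis_unique hG hA hbarA hM hhat DQ D'Q').
Qed.
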